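(* Let $k\ge 1$ and let $\pi=00\cdots 0$ be the pattern consisting of $k$ zeros. Then for all $n\ge 1$, \[ |\mathbf{I}_n(\pi)| = |L_{n+1,k-1}|. \]
   Context: An inversion sequence of length $n$ is a sequence of integers $e=e_1\cdots e_n$ with $0\le e_i<i$ for all $1\le i\le n$; the set of these is $\mathbf{I}_n$. A sequence $e$ contains a pattern (finite integer sequence) $\pi$ of length $k$ if there are indices $i_1<\cdots<i_k$ such that $e_{i_1}\cdots e_{i_k}$ is order isomorphic to $\pi$ (i.e. its entries compare pairwise, with respect to $<,=,>$, exactly as the corresponding entries of $\pi$); otherwise it avoids $\pi$. $\mathbf{I}_n(\pi)$ is the set of $e\in\mathbf{I}_n$ avoiding $\pi$. A label-increasing tree on $n$ vertices is a rooted unordered tree in which the $n$ vertices are labeled with distinct labels from $\{0,\dots,n-1\}$ and labels increase along any path from the root to a leaf. It has branching bounded by $k$ if each vertex has at most $k$ children. $L_{n,k}$ denotes the set of $n$-vertex label-increasing trees with branching bounded by $k$. *)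

(* Defs.v *)
From mathcomp Require Import all_boot.
From mathcomp Require Import boolp.

Set Implicit Arguments.
Unset Strict Implicit.
Unset Printing Implicit Defensive.

Definition order_isomorphic (s t : seq nat) : Prop :=
  size s = size t /\
  forall i j, i < size s -> j < size s ->
    (nth 0 s i < nth 0 s j) = (nth 0 t i < nth 0 t j) /\
    (nth 0 s i == nth 0 s j) = (nth 0 t i == nth 0 t j).

Definition contains (e pi : seq nat) : Prop :=
  exists2 s : seq nat, subseq s e & order_isomorphic s pi.

Definition avoids (e pi : seq nat) : Prop := ~ contains e pi.

(* Positions are counted from 0 here, so the condition e_i < i on 1-based      *)
(* positions reads [nth 0 e i <= i].                                          *)
Definition inversion_sequence (e : seq nat) : Prop :=
  forall i, i < size e -> nth 0 e i <= i.

(* Entries of an inversion sequence of length n are smaller than n, so all of *)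
(* them occur among the tuples over 'I_n.                                     *)
Definition I_avoid (n : nat) (pi : seq nat) : {set n.-tuple 'I_n} :=
  [set e : n.-tuple 'I_n | `[< inversion_sequence (map val e) /\
                               avoids (map val e) pi >]].

Definition adj (V : finType) (E : {set {set V}}) : rel V :=
  [rel x y | (x != y) && ([set x; y] \in E)].

Definition simple_path (V : finType) (E : {set {set V}}) (x : V) (p : seq V) :
    bool :=
  path (adj E) x p && uniq (x :: p).

Definition connected_graph (V : finType) (E : {set {set V}}) : Prop :=
  forall x y : V, connect (adj E) x y.

(* A closed walk x, y, x along one edge is a duplicate-free [cycle] of size 2; *)
(* genuine cycles of a simple graph have at least 3 vertices.                 *)
Definition acyclic_graph (V : finType) (E : {set {set V}}) : Prop :=
  forall c : seq V, uniq c -> cycle (adj E) c -> size c <= 2.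

(* The first clause says that E is the edge set of a simple graph on V. *)
Definition is_tree (V : finType) (E : {set {set V}}) : Prop :=
  [/\ forall e, e \in E -> #|e| = 2, connected_graph E & acyclic_graph E].

(* w is a child of v in the tree E rooted at r: v is the last vertex before w *)
(* on the path from r to w.                                                   *)
Definition is_child (V : finType) (r : V) (E : {set {set V}}) (v w : V) : Prop :=
  exists2 p : seq V, simple_path E r (rcons p w) & last r p = v.

Definition children (V : finType) (r : V) (E : {set {set V}}) (v : V) : {set V} :=
  [set w | `[< is_child r E v w >]].

Definition is_leaf (V : finType) (r : V) (E : {set {set V}}) (v : V) : Prop :=
  children r E v = set0.

Definition label_increasing (n : nat) (r : 'I_n) (E : {set {set 'I_n}}) : Prop :=
  forall p : seq 'I_n, simple_path E r p -> is_leaf r E (last r p) ->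
    sorted ltn (map val (r :: p)).

Definition branching_bounded (V : finType) (k : nat) (r : V)
    (E : {set {set V}}) : Prop :=
  forall v : V, #|children r E v| <= k.

(* A rooted tree is a pair (root, edge set). The n vertices carry n distinct  *)
(* labels from {0, ..., n - 1}, so every label is used once and the vertices  *)
(* are identified with their labels; trees are counted up to label-preserving *)
(* isomorphism, i.e. two are equal iff roots and edge sets are.               *)
Definition L (n k : nat) : {set 'I_n * {set {set 'I_n}}} :=
  [set t | `[< [/\ is_tree t.2, label_increasing t.1 t.2
                 & branching_bounded k t.1 t.2] >]].

(* Main.v *)
(** Send the inversion sequence e_0 ... e_{n-1} to the tree on {0, ..., n} with
root 0 in which the parent of i + 1 is e_i <= i. The increasing trees are exactly
the graphs in which every nonzero vertex has a unique smaller neighbour, so this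
is a bijection onto them. The number of children of v is the number of
occurrences of v in e, and e avoids 0^k iff every value occurs at most k - 1
times. *)
Require Import Defs.
From mathcomp Require Import all_boot.
From mathcomp Require Import boolp.

Set Implicit Arguments.
Unset Strict Implicit.
Unset Printing Implicit Defensive.

(** * Constant patterns and multiplicities *)

Lemma contains_nseq0 (k : nat) (s : seq nat) : 0 < k ->
  contains s (nseq k 0) <-> exists v, k <= count_mem v s.
Proof.
move=> k_gt0; split=> [[t sub_ts [size_t iso]] | [v le_k]].
  exists (nth 0 t 0); apply: leq_trans (leq_count_subseq (pred1 _) sub_ts).
  rewrite size_nseq in size_t; rewrite -{1}size_t leq_eqVlt eq_sym -all_count.
  (* The pattern is constant, so all entries of [t] equal its first one. *)
  apply/orP; left.
  apply/(all_nthP 0) => i lt_i /=.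
  have [_ ->] := iso i 0 lt_i (leq_ltn_trans (leq0n _) lt_i).
  by rewrite !nth_nseq !if_same.
exists (nseq k v); last first.
  split=> [|i j]; rewrite !size_nseq // => lt_i lt_j.
  by rewrite !nth_nseq lt_i lt_j !ltnn !eqxx.
(* The occurrences of [v] in [s] form a constant subsequence of length at least [k]; its first [k]
   entries suffice. *)
apply: subseq_trans (filter_subseq (pred1 v) s).
have /all_pred1P -> := filter_all (pred1 v) s.
rewrite size_filter -(subnKC le_k) nseqD.
exact: prefix_subseq.
Qed.

(** * Graphs with unique smaller neighbours *)

Local Arguments adj : simpl never.

Lemma adj_sym (V : finType) (E : {set {set V}}) : symmetric (adj E).
Proof. by move=> x y; rewrite /adj /= eq_sym setUC. Qed.

(* In an increasing tree the parent of [w] is its only smaller neighbour. *)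
Definition unique_smaller_neighbour (n : nat) (E : {set {set 'I_n.+1}}) : Prop :=
  forall w : 'I_n.+1, w != ord0 -> exists! v : 'I_n.+1, v < w /\ adj E v w.

Section RecursiveTree.

Variables (n : nat) (E : {set {set 'I_n.+1}}).

Let up : rel 'I_n.+1 := [rel v w : 'I_n.+1 | (v < w) && adj E v w].

Lemma path_up_simple (x : 'I_n.+1) p : path up x p -> simple_path E x p.
Proof.
move=> up_p; apply/andP; split; first by apply: sub_path up_p => v w /andP[].
rewrite -(map_inj_uniq val_inj); apply: (sorted_uniq ltn_trans ltnn).
by rewrite sorted_map; apply: sub_path up_p => v w /andP[].
Qed.

Hypothesis uniqE : unique_smaller_neighbour E.

Lemma up_functional v v' w : up v w -> up v' w -> v = v'.
Proof.
move=> /andP[lt_vw adj_vw] /andP[lt_v'w adj_v'w].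
have w_neq0: w != ord0 by rewrite -val_eqE /= -lt0n (leq_ltn_trans _ lt_vw).
by have [u [_ uniq_u]] := uniqE w_neq0; rewrite -(uniq_u v) ?(uniq_u v').
Qed.

(** Passing to the smaller neighbour lowers the label, so the descent from [w] stops at 0; read
    backwards it is the path. *)
Lemma up_path_exists w : exists2 p, path up ord0 p & last ord0 p = w.
Proof.
have [m] := ubnP (val w); elim: m w => // m IHm w /ltnSE-le_wm.
have [-> | w_neq0] := eqVneq w ord0; first by exists [::].
have [v [[lt_vw adj_vw] _]] := uniqE w_neq0.
have [p up_p last_p] := IHm v (leq_trans lt_vw le_wm).
exists (rcons p w); rewrite ?last_rcons // rcons_path up_p last_p /=.
by apply/andP.
Qed.

(* A step back down would have to revisit the unique smaller neighbour. *)
Lemma simple_path_up p : simple_path E ord0 p -> path up ord0 p.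
Proof.
elim/last_ind: p => // p w IHp /andP[].
rewrite rcons_path -rcons_cons rcons_uniq => /andP[adj_p adj_w] /andP[w_notin uniq_p].
have up_p := IHp (introT andP (conj adj_p uniq_p)).
rewrite rcons_path up_p /up /= adj_w andbT ltnNge; apply/negP => le_w.
case/lastP: p => [|p v] in {IHp uniq_p} adj_w w_notin up_p adj_p le_w *.
  move: w_notin; rewrite inE -val_eqE /=.
  by rewrite /= leqn0 in le_w; rewrite le_w.
rewrite last_rcons in adj_w le_w; move: up_p; rewrite rcons_path => /andP[_ up_v].
have: up w v.
  rewrite /up /= adj_sym adj_w andbT ltn_neqAle le_w andbT val_eqE.
  by case/andP: adj_w; rewrite eq_sym.
move/(up_functional up_v) => eq_w; move/negP: w_notin; apply.
by rewrite -eq_w -rcons_cons mem_rcons inE mem_last orbT.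
Qed.

Lemma unique_smaller_connected : connected_graph E.
Proof.
have conn0 w : connect (adj E) ord0 w.
  have [p up_p <-] := up_path_exists w.
  by apply/connectP; exists p; rewrite // (andP (path_up_simple up_p)).1.
move=> x y; apply: connect_trans (conn0 y).
by rewrite (sym_connect_sym (@adj_sym _ E)).
Qed.

(* The two neighbours on a cycle of its largest vertex would both be its      *)
(* unique smaller neighbour.                                                  *)
Lemma unique_smaller_acyclic : acyclic_graph E.
Proof.
move=> c uniq_c cycle_c; case: c => // x0 c0 in uniq_c cycle_c *.
set c := x0 :: c0 in uniq_c cycle_c *.
pose m := [arg max_(x > x0 in c) val x].
have [m_in max_m]: m \in c /\ forall x, x \in c -> x <= m.
  by rewrite /m; case: arg_maxnP; rewrite ?mem_head.
have [i s rot_c] := rot_to m_in.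
rewrite -(size_rot i) rot_c.
have uniq_s : uniq (m :: s) by rewrite -rot_c rot_uniq.
have cycle_s : cycle (adj E) (m :: s) by rewrite -rot_c rot_cycle.
have lt_m x : x \in s -> adj E x m -> up x m.
  move=> x_in adj_x; rewrite /up /= adj_x andbT ltn_neqAle max_m ?andbT.
    by rewrite val_eqE; case/andP: adj_x.
  by rewrite -(mem_rot i) rot_c inE x_in orbT.
(* Cycles with one or two vertices meet the bound; in a longer one [a] and [b] are the two
   neighbours of [m]. *)
case: s => [|a s] // in rot_c uniq_s cycle_s lt_m *.
case/lastP: s => [|s b] // in rot_c uniq_s cycle_s lt_m *.
move: cycle_s; rewrite /= !rcons_path last_rcons => /and3P[adj_a _ adj_b].
have eq_ab: a = b.
  apply: (@up_functional a b m); apply: lt_m => //.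
  - exact: mem_head.
  - by rewrite adj_sym.
  - by rewrite inE mem_rcons mem_head orbT.
by move: uniq_s; rewrite eq_ab /= mem_rcons mem_head !andbF.
Qed.

Lemma unique_smaller_label_increasing : label_increasing ord0 E.
Proof.
move=> p /simple_path_up up_p _.
by rewrite sorted_map; apply: sub_path up_p => v w /andP[].
Qed.

Lemma unique_smaller_children v : children ord0 E v = [set w | up v w].
Proof.
apply/setP => w; rewrite !inE; apply/asboolP/idP => [[p simple_p <-] | up_vw].
  by have := simple_path_up simple_p; rewrite rcons_path => /andP[].
have [p up_p last_p] := up_path_exists v.
by exists p => //; apply: path_up_simple; rewrite rcons_path up_p last_p.
Qed.

End RecursiveTree.

(** * Simple paths from the root of an acyclic graph *)

Section Tree.

Variables (V : finType) (r : V) (E : {set {set V}}).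
Hypothesis acyclicE : acyclic_graph E.

Lemma simple_path_adj_last p v : simple_path E r (rcons p v) -> adj E (last r p) v.
Proof. by rewrite /simple_path rcons_path => /andP[/andP[]]. Qed.

Lemma simple_path_catl p q : simple_path E r (p ++ q) -> simple_path E r p.
Proof.
rewrite /simple_path cat_path -cat_cons cat_uniq.
by case/andP=> /andP[-> _] /andP[].
Qed.

(* Otherwise the two penultimate vertices are joined by a path avoiding [v],  *)
(* which closes up through [v] to a cycle.                                    *)
Lemma acyclic_penultimate p q v :
    simple_path E r (rcons p v) -> simple_path E r (rcons q v) ->
  last r p = last r q.
Proof.
(* [e] is adjacency with [v] deleted; a simple path ending in [v] stays inside it until its last
   step. *)
pose e := [rel x y | [&& adj E x y, x != v & y != v]].
have e_sym : symmetric e by move=> x y; rewrite /= adj_sym [(y != v) && _]andbC.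
have conn_e s : simple_path E r (rcons s v) -> connect e r (last r s) /\ last r s != v.
  case/andP; rewrite rcons_path -rcons_cons rcons_uniq.
  case/andP=> adj_s adj_v /andP[v_notin _]; split; last first.
    by apply: contraNneq v_notin => <-; apply: mem_last.
  apply/connectP; exists s => //; elim: s r adj_s v_notin {adj_v} => //= x s IHs y.
  case/andP=> adj_yx adj_s; rewrite inE negb_or eq_sym => /andP[-> v_notin].
  rewrite adj_yx IHs // andbT /=.
  by move: v_notin; rewrite inE negb_or eq_sym => /andP[].
move=> simple_p simple_q.
have [[conn_p p_neq] [conn_q q_neq]] := (conn_e _ simple_p, conn_e _ simple_q).
have: connect e (last r p) (last r q).
  by apply: connect_trans conn_q; rewrite (sym_connect_sym e_sym).
case/connectP=> s0 e_s0 /esym; case: (shortenP e_s0) => s e_s uniq_s _ last_s.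
have adj_s : path (adj E) (last r p) s by apply: sub_path e_s => x y /and3P[].
have v_notin : v \notin last r p :: s.
  rewrite inE negb_or eq_sym p_neq /=.
  elim: s (last r p) e_s {uniq_s last_s adj_s} => //= x s IHs y.
  case/andP=> /and3P[_ _ x_neq] e_s.
  by rewrite inE negb_or eq_sym x_neq (IHs x).
(* A nonempty [s] would give this cycle three vertices, so [s] is empty and its endpoints agree. *)
have: size [:: v, last r p & s] <= 2.
  apply: acyclicE; first by rewrite cons_uniq v_notin.
  rewrite /cycle rcons_path -/(path _ _ _) last_cons last_s.
  rewrite (simple_path_adj_last simple_q) andbT /= adj_s andbT.
  by rewrite adj_sym simple_path_adj_last.
by case: s last_s {e_s uniq_s adj_s v_notin}.
Qed.

(** The path witnessing [is_child] may differ from [p]. If [w] lay on [p], cutting [p] at [w] and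
    stepping to the end of [p] would make [w] penultimate there; by uniqueness the witnessing path
    would then visit [w] twice. *)
Lemma child_simple_path p w :
  simple_path E r p -> is_child r E (last r p) w -> simple_path E r (rcons p w).
Proof.
move=> simple_p [q simple_q last_q].
have adj_w := simple_path_adj_last simple_q; rewrite last_q in adj_w.
case/andP: (simple_p) => adj_p uniq_p.
rewrite /simple_path rcons_path adj_p adj_w -rcons_cons rcons_uniq uniq_p !andbT.
apply/negP; case/lastP: p => [|p v] in simple_p last_q adj_w adj_p uniq_p *.
  by rewrite inE => /eqP eq_w; move: adj_w; rewrite eq_w /adj /= eqxx.
rewrite last_rcons in last_q adj_w.
rewrite -rcons_cons mem_rcons inE => /predU1P[eq_w | w_in].
  by move: adj_w; rewrite eq_w /adj /= eqxx.
case/splitPl: w_in simple_p uniq_p {adj_p} => p1 p2 last_p1 simple_p uniq_p.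
have simple_p1 : simple_path E r (rcons p1 v).
  apply/andP; split.
    rewrite rcons_path last_p1 adj_sym adj_w andbT.
    suff /andP[]: simple_path E r p1 by [].
    by move: simple_p; rewrite rcons_cat => /simple_path_catl.
  move: uniq_p; rewrite -!rcons_cons !rcons_uniq -cat_cons cat_uniq mem_cat negb_or.
  by case/andP=> /andP[-> _] /andP[-> _].
case/lastP: q => [|q v'] in simple_q last_q *.
  by move: uniq_p; rewrite /= -last_q /= mem_rcons mem_head.
rewrite last_rcons in last_q; rewrite {v'}last_q in simple_q.
have simple_q' : simple_path E r (rcons q v).
  by move: simple_q; rewrite -[rcons _ w]cats1 => /simple_path_catl.
have last_q := acyclic_penultimate simple_p1 simple_q'; rewrite last_p1 in last_q.
case/andP: simple_q => _; rewrite -!rcons_cons rcons_uniq mem_rcons inE.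
by rewrite last_q mem_last orbT.
Qed.

(** [label_increasing] speaks only of paths ending in a leaf; this extends its reach to all simple
    paths. *)
Lemma simple_path_extend_leaf p : simple_path E r p ->
  exists2 q, simple_path E r (p ++ q) & is_leaf r E (last r (p ++ q)).
Proof.
have [m] := ubnP (#|V| - size p); elim: m p => // m IHm p lt_m simple_p.
have [leaf_p | /set0Pn[w]] := eqVneq (children r E (last r p)) set0.
  by exists [::]; rewrite cats0.
rewrite inE => /asboolP/(child_simple_path simple_p) simple_w.
have [|q simple_q leaf_q] := IHm (rcons p w) _ simple_w; last first.
  by exists (w :: q); rewrite -cat_rcons.
have: size (r :: p) <= #|V| by case/andP: simple_p => _ /card_uniqP <-; apply: max_card.
rewrite size_rcons /= => lt_p.
by rewrite -ltnS (leq_trans _ lt_m) // ltnS subnS prednK ?subn_gt0.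
Qed.

End Tree.

Lemma connected_simple_path (V : finType) (E : {set {set V}}) x y :
  connected_graph E -> exists2 p, simple_path E x p & last x p = y.
Proof.
move=> /(_ x y)/connectP[p adj_p ->].
by case: (shortenP adj_p) => q adj_q uniq_q _; exists q => //; apply/andP.
Qed.

(** * Unique smaller neighbours in increasing trees *)

Section IncreasingTree.

Variables (n : nat) (r : 'I_n.+1) (E : {set {set 'I_n.+1}}).
Hypotheses (treeE : is_tree E) (incrE : label_increasing r E).

(** Labels increase along an extension of [p] to a leaf, hence along its prefix [p]. *)
Lemma increasing_simple_path p : simple_path E r p -> path ltn r (map val p).
Proof.
have [_ _ acyclicE] := treeE.
case/(simple_path_extend_leaf acyclicE) => q simple_pq /(incrE simple_pq).
by rewrite /= map_cat cat_path => /andP[].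
Qed.

Lemma increasing_root : r = ord0.
Proof.
have [_ connE _] := treeE.
have [p /increasing_simple_path] := connected_simple_path r ord0 connE.
case/lastP: p => // p x; rewrite last_rcons map_rcons rcons_path => /andP[_ lt_x] eq_x.
by rewrite eq_x in lt_x.
Qed.

(** Labels on the path to [v] are at most [v], so [w] is new. *)
Lemma increasing_path_lt p (v w : 'I_n.+1) :
    simple_path E r p -> last r p = v ->
  v < w -> adj E v w -> simple_path E r (rcons p w).
Proof.
move=> simple_p last_p lt_vw adj_vw.
case/andP: (simple_p) => adj_p uniq_p.
rewrite /simple_path rcons_path adj_p last_p adj_vw -rcons_cons rcons_uniq uniq_p andbT.
have: sorted ltn (map val (rcons (r :: p) w)).
  rewrite map_rcons /= rcons_path increasing_simple_path //=.
  by rewrite last_map last_p.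
move/(sorted_uniq ltn_trans ltnn).
by rewrite (map_inj_uniq val_inj) rcons_uniq => /andP[->].
Qed.

(** The predecessor of [w] on a simple path from the root is smaller. Any smaller neighbour is also
    penultimate on some simple path to [w], and penultimate vertices are unique. *)
Lemma increasing_unique_smaller : unique_smaller_neighbour E.
Proof.
move=> w w_neq0; have [_ connE acyclicE] := treeE.
have [p simple_p last_p] := connected_simple_path r w connE.
case/lastP: p => [|p v] in simple_p last_p.
  by rewrite -increasing_root -last_p eqxx in w_neq0.
rewrite last_rcons in last_p; rewrite {v}last_p in simple_p.
exists (last r p); split=> [|v [lt_vw adj_vw]].
  split; last exact: simple_path_adj_last simple_p.
  have := increasing_simple_path simple_p.
  by rewrite map_rcons rcons_path last_map => /andP[].
have [q simple_q last_q] := connected_simple_path r v connE.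
rewrite -last_q; apply: (acyclic_penultimate acyclicE simple_p).
exact: (increasing_path_lt simple_q last_q).
Qed.

End IncreasingTree.

(** * The tree of an inversion sequence *)

Definition tree_edges (n : nat) (e : n.-tuple 'I_n) : {set {set 'I_n.+1}} :=
  [set [set widen_ord (leqnSn n) (tnth e i); lift ord0 i] | i : 'I_n].

Section TreeEdges.

Variables (n : nat) (e : n.-tuple 'I_n).
Hypothesis inv_e : forall i, tnth e i <= i.

Lemma tree_edges_card2 a : a \in tree_edges e -> #|a| = 2.
Proof.
case/imsetP=> i _ ->; rewrite cards2 -val_eqE /=.
by rewrite neq_ltn /bump leq0n ltnS inv_e.
Qed.

Lemma adj_tree_edges (v : 'I_n.+1) (i : 'I_n) :
  (v < lift ord0 i) && adj (tree_edges e) v (lift ord0 i) = (v == tnth e i :> nat).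
Proof.
apply/andP/eqP => [[lt_v /andP[_ /imsetP[j _ eq_vi]]] | eq_v].
  have lt_j : tnth e j < lift ord0 j by rewrite /= /bump leq0n ltnS.
  have: v \in [set v; lift ord0 i] by apply: set21.
  have: lift ord0 i \in [set v; lift ord0 i] by apply: set22.
  rewrite eq_vi !in_set2 -!val_eqE.
  (* Only the matching i = j, v = e_j survives; the other three clash with [lt_v] and [lt_j]. *)
  case/orP=> /eqP/= eq_i /orP[]/eqP/= eq_v.
  - by move: lt_v; rewrite /= eq_i eq_v ltnn.
  - by move: lt_j; rewrite /= -eq_i -eq_v ltnNge (ltnW lt_v).
  - by move: eq_i; rewrite eq_v /bump !leq0n => -[/ord_inj->].
  - by move: lt_v; rewrite /= eq_i eq_v ltnn.
have lt_v : v < lift ord0 i by rewrite eq_v /= /bump leq0n ltnS.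
split=> //; rewrite /adj /= -val_eqE neq_ltn lt_v /=.
by apply/imsetP; exists i => //; congr [set _; _]; apply: val_inj.
Qed.

Lemma tree_edges_unique_smaller : unique_smaller_neighbour (tree_edges e).
Proof.
move=> w; case: (unliftP ord0 w) => [i -> _ | ->]; last by rewrite eqxx.
exists (widen_ord (leqnSn n) (tnth e i)); split.
  by apply/andP; rewrite adj_tree_edges.
by move=> v /andP; rewrite adj_tree_edges => /eqP eq_v; apply: val_inj.
Qed.

(** The children of [v] are the i + 1 with e_i = [v], so [lift ord0] carries the positions of [v] in
    [e] onto them. *)
Lemma tree_edges_children v :
  #|children ord0 (tree_edges e) v| = count_mem (val v) (map val e).
Proof.
rewrite (unique_smaller_children tree_edges_unique_smaller).
rewrite count_map -sum1_count big_tuple /= sum1_card.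
rewrite -(card_imset _ (@lift_inj n.+1 ord0)); apply: eq_card => w.
rewrite inE; apply/idP/imsetP => [|[i eq_v ->]]; last first.
  by rewrite /= adj_tree_edges eq_sym.
case: (unliftP ord0 w) => [i -> | ->]; last by rewrite ltn0.
by rewrite /= adj_tree_edges => eq_v; exists i; rewrite // unfold_in -/(_ == _) eq_sym.
Qed.

Lemma tree_edges_increasing_tree :
  is_tree (tree_edges e) /\ label_increasing ord0 (tree_edges e).
Proof.
have uniq_e := tree_edges_unique_smaller.
split; last exact: unique_smaller_label_increasing.
split; first exact: tree_edges_card2.
  exact: unique_smaller_connected.
exact: unique_smaller_acyclic.
Qed.

End TreeEdges.

Lemma tree_edges_inj n (e f : n.-tuple 'I_n) :
    (forall i, tnth e i <= i) -> (forall i, tnth f i <= i) ->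
  tree_edges e = tree_edges f -> e = f.
Proof.
move=> inv_e inv_f eq_ef; apply: eq_from_tnth => i; apply: val_inj; apply/eqP.
have:= adj_tree_edges inv_f (widen_ord (leqnSn n) (tnth e i)) i.
by rewrite -eq_ef adj_tree_edges //= eqxx.
Qed.

(** The sequence lists the smaller neighbours. Each edge joins its larger end to that end's unique
    smaller neighbour, so no edge is left over. *)
Lemma tree_edges_surj n (E : {set {set 'I_n.+1}}) :
    (forall a, a \in E -> #|a| = 2) -> unique_smaller_neighbour E ->
  exists2 e : n.-tuple 'I_n, forall i, tnth e i <= i & E = tree_edges e.
Proof.
move=> card2 uniqE.
have ex_par (i : 'I_n) : exists v : 'I_n, [&& v <= i &
    adj E (widen_ord (leqnSn n) v) (lift ord0 i)].
  have [|v [[lt_v adj_v] _]] := uniqE (lift ord0 i); first by rewrite eq_sym neq_lift.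
  have le_v : v <= i by rewrite /= /bump leq0n ltnS in lt_v.
  (* The smaller neighbour of i + 1 is at most i, hence below n, so it can be an entry. *)
  exists (Ordinal (leq_ltn_trans le_v (ltn_ord i))); rewrite /= le_v.
  by rewrite (_ : widen_ord _ _ = v) //; apply: val_inj.
pose e := [tuple xchoose (ex_par i) | i < n].
have e_par i : (tnth e i <= i) && adj E (widen_ord (leqnSn n) (tnth e i)) (lift ord0 i).
  by rewrite tnth_mktuple; apply: (xchooseP (ex_par i)).
exists e => [i|]; first by case/andP: (e_par i).
apply/setP=> a; apply/idP/imsetP => [a_in | [i _ ->]]; last first.
  by case/andP: (e_par i) => _ /andP[].
have [x [y [lt_xy eq_a]]] : exists x y : 'I_n.+1, x < y /\ a = [set x; y].
  have /cards2P[x [y [neq_xy ->]]] := introT eqP (card2 a a_in).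
  move: neq_xy; rewrite -val_eqE neq_ltn => /orP[]lt_xy.
    by exists x, y.
  by exists y, x; rewrite setUC.
case: (unliftP ord0 y) => [i eq_y | eq_y]; last by rewrite eq_y in lt_xy.
exists i => //; rewrite eq_a eq_y; congr [set _; _].
have [|v [_ uniq_v]] := uniqE y; first by rewrite eq_y eq_sym neq_lift.
apply: etrans (esym (uniq_v x _)) (uniq_v _ _); last first.
  case/andP: (e_par i) => le_i adj_i; rewrite eq_y.
  by rewrite /= /bump leq0n ltnS.
by rewrite /adj /= -eq_a a_in andbT -val_eqE neq_ltn lt_xy.
Qed.

(** * The bijection and the branching bound *)

Lemma inversion_sequence_tuple n (e : n.-tuple 'I_n) :
  inversion_sequence (map val e) <-> forall i, tnth e i <= i.
Proof.
split=> [inv_e i | inv_e i].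
  have := inv_e i; rewrite size_map size_tuple => /(_ (ltn_ord i)).
  by rewrite (nth_map (tnth e i)) ?size_tuple // -tnth_nth.
rewrite size_map size_tuple => lt_i.
rewrite (nth_map (tnth e (Ordinal lt_i))) ?size_tuple //.
by rewrite -(tnth_nth _ e (Ordinal lt_i)); apply: inv_e.
Qed.

Lemma in_I_avoid_tree k n (e : n.-tuple 'I_n) :
  e \in I_avoid n (nseq k.+1 0) <->
  (forall i, tnth e i <= i) /\ branching_bounded k ord0 (tree_edges e).
Proof.
rewrite inE; split=> [/asboolP[/inversion_sequence_tuple inv_e avoid_e] | [inv_e le_k]].
  split=> // v; rewrite tree_edges_children // leqNgt; apply/negP => lt_k.
  by apply: avoid_e; apply/contains_nseq0 => //; exists (val v).
apply/asboolP; split; first exact/inversion_sequence_tuple.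
case/contains_nseq0 => // v lt_k.
have /mapP[i _ eq_v] : v \in map val e by rewrite -has_pred1 has_count (leq_trans _ lt_k).
(* A value occurring in [e] is below n, so it is a vertex, to which the branching bound applies. *)
have := le_k (widen_ord (leqnSn n) i).
by rewrite tree_edges_children //= -eq_v leqNgt lt_k.
Qed.

Theorem theorem4p1 (k : nat) (hk : 1 <= k) (n : nat) (hn : 1 <= n) :
  #|I_avoid n (nseq k 0)| = #|L n.+1 (k - 1)|.
Proof.
case: k hk => // k _; rewrite subn1 /=.
pose f (e : n.-tuple 'I_n) := (ord0 : 'I_n.+1, tree_edges e).
(* [f] is injective on the avoiding sequences, so it remains to identify its image with the bounded
   increasing trees. *)
rewrite -(@card_in_imset _ _ f) => [|e e' /in_I_avoid_tree[inv_e _]]; last first.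
  by case/in_I_avoid_tree=> inv_e' _ [/tree_edges_inj]; apply.
apply: eq_card => -[r E]; rewrite inE.
apply/imsetP/asboolP => [[e /in_I_avoid_tree[inv_e le_k] [-> ->]] | [/= treeE incrE le_k]].
  by have [treeE incrE] := tree_edges_increasing_tree inv_e.
have [card2 _ _] := treeE.
have [e inv_e eqE] := tree_edges_surj card2 (increasing_unique_smaller treeE incrE).
have r0 := increasing_root treeE incrE.
exists e; last by rewrite r0 eqE.
by apply/in_I_avoid_tree; split=> //; rewrite -r0 -eqE.
Qed.
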